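(* For every positive integer $N$, $$\sum_{\mu\in\mathcal{RL}_N} q^{|\mu|}=\sum_{\lambda\in\mathcal{ROP}_N} q^{|\lambda|},$$ where $\mathcal{RL}_N$ is the set of reduced lecture hall partitions of width $N$ and $\mathcal{ROP}_N$ is the set of $N$-party reduced odd partitions.
   Context: A partition is a finite weakly decreasing sequence $\lambda=(\lambda_1\ge\lambda_2\ge\dots\ge\lambda_\ell>0)$ of positive integers (the empty partition $\emptyset$ is allowed); $\ell(\lambda)=\ell$ is its length, $|\lambda|=\sum_i\lambda_i$ its size, and $m_i(\lambda)$ the multiplicity of $i$ as a part. Partitions are identified with sequences obtained by appending zeros. Lecture hall partitions. For a positive integer $N$, $\mathcal{L}_N$ is the set of partitions $\mu$ with $\ell(\mu)\le N$ and $$\frac{\mu_1}{N}\ge\frac{\mu_2}{N-1}\ge\dots\ge\frac{\mu_{\ell(\mu)}}{N-\ell(\mu)+1}$$ (lecture hall partitions of width $N$; $\emptyset\in\mathcal{L}_N$). A partition $\mu\in\mathcal{L}_N$ is reduced if for every $i$ with $1\le i\le \ell(\mu)$ the sequence obtained from $\mu$ by replacing $\mu_i$ with $\mu_i-(N-i+1)$ (and leaving the other entries unchanged) is not in $\mathcal{L}_N$; here trailing zeros are deleted, and a sequence that is not a partition is not in $\mathcal{L}_N$. $\mathcal{RL}_N$ is the set of reduced elements of $\mathcal{L}_N$. Odd partitions. $\mathcal{OP}_N$ is the set of partitions all of whose parts are odd and at most $2N$ (so parts lie in $\{1,3,\dots,2N-1\}$), and $\mathcal{ROP}_N=\{\lambda\in\mathcal{OP}_N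 : m_{2k-1}(\lambda)\le N-k \text{ for all } 1\le k\le N\}$. *)

(* Defs.v *)
From mathcomp Require Import all_boot all_order all_algebra.
From mathcomp Require Import boolp classical_sets functions cardinality fsbigop.

Set Implicit Arguments.
Unset Strict Implicit.
Unset Printing Implicit Defensive.
Import Order.TTheory GRing.Theory Num.Theory.
Local Open Scope ring_scope.
Local Open Scope classical_set_scope.

(* Entries are indexed from 0: the i-th part lambda_i of the literature is     *)
(* s`_(i - 1), and the weight N - i + 1 attached to it is (N - (i - 1))%N.     *)
(* [nth 0%N s] gives the identification of s with a sequence ending in zeros.  *)
Definition is_partition (s : seq nat) : bool := sorted geq s && (0%N \notin s).

(* All denominators are nonzero, since i.+1 < size mu <= N. *)
Definition lecture_hall (N : nat) : set (seq nat) :=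
  [set mu | [/\ is_partition mu, (size mu <= N)%N &
     forall i : nat, (i.+1 < size mu)%N ->
       (nth 0%N mu i.+1)%:R / (N - i.+1)%:R
         <= (nth 0%N mu i)%:R / (N - i)%:R :> rat]].

(* The subtraction takes place in int and the comparison is made on the        *)
(* zero-extended sequence: a negative entry, or a sequence which is not weakly *)
(* decreasing, is matched by no nu, and trailing zeros are immaterial.         *)
Definition reduces_at (N i : nat) (mu nu : seq nat) : Prop :=
  forall j : nat,
    (nth 0%N nu j)%:Z =
      (nth 0%N mu j)%:Z - (if j == i then (N - i)%:Z else 0).

Definition reduced_lecture_hall (N : nat) : set (seq nat) :=
  [set mu | lecture_hall N mu /\
     forall i : nat, (i < size mu)%N ->
       ~ exists nu : seq nat, lecture_hall N nu /\ reduces_at N i mu nu].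

Definition odd_partition (N : nat) : set (seq nat) :=
  [set la | is_partition la /\
     forall p : nat, p \in la -> odd p /\ (p <= 2 * N)%N].

Definition reduced_odd_partition (N : nat) : set (seq nat) :=
  [set la | odd_partition N la /\
     forall k : nat, (1 <= k <= N)%N ->
       (count_mem (2 * k - 1)%N la <= N - k)%N].

(* A sum [\sum_(s \in A) 'X^(sumn s)] in {poly int} is 0 by convention when A  *)
(* is infinite. No finiteness assumption is lost in equating two such sums     *)
(* here: the set of reduced odd partitions is finite and contains the empty    *)
(* partition, so its sum is a nonzero polynomial, and the equality can only    *)
(* hold if [reduced_lecture_hall N] is finite too.                             *)
Lemma finite_bounded_seq (b m : nat) :
  finite_set [set s : seq nat | (size s <= m)%N /\ all (leq^~ b) s].
Proof.
elim: m => [|m IHm].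
  apply: (sub_finite_set _ (finite_set1 [::])) => s /= [].
  by rewrite leqn0 size_eq0 => /eqP.
apply: (@sub_finite_set _ _ ([set [::]] `|`
  ((fun xs : nat * seq nat => xs.1 :: xs.2) @`
     (`I_b.+1 `*` [set s : seq nat | (size s <= m)%N /\ all (leq^~ b) s])))).
  move=> [|x s] /= [szs alls]; first by left.
  by right; move: alls => /andP[xb sb]; exists (x, s).
rewrite finite_setU; split; first exact: finite_set1.
by apply: finite_image; apply: finite_setX.
Qed.

Lemma size_le_count (b c : nat) (s : seq nat) :
  (forall x, x \in s -> (x < b)%N) ->
  (forall x, (count_mem x s <= c)%N) -> (size s <= b * c)%N.
Proof.
elim: b s => [|b IHb] s sb sc.
  by case: s sb {sc} => //= x s /(_ x); rewrite mem_head => /(_ isT).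
rewrite mulSn -(count_predC (pred1 b) s) leq_add // -size_filter IHb // => x.
  rewrite mem_filter /= => /andP[xb /sb]; by rewrite ltnS leq_eqVlt (negPf xb).
apply: leq_trans (sc x); rewrite count_filter; apply: sub_count => y /=.
by case/andP.
Qed.

Lemma finite_reduced_odd_partition (N : nat) :
  finite_set (reduced_odd_partition N).
Proof.
apply: (sub_finite_set _ (finite_bounded_seq (2 * N) ((2 * N).+1 * N))).
move=> la [[_ laP] lac] /=; split; last by apply/allP => x /laP[].
apply: size_le_count => [x /laP[_]|x]; first by rewrite ltnS.
case: (boolP (x \in la)) => [xla|/count_memPn -> //].
have [ox xN] := laP _ xla.
have xE : x = (2 * x./2.+1 - 1)%N.
  by rewrite mulnS add2n subn1 /= mul2n -[LHS]odd_double_half ox.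
rewrite xE; apply: leq_trans (lac _ _) (leq_subr _ _).
rewrite /= -(ltn_pmul2l (isT : 0 < 2)%N); apply: leq_trans xN.
by rewrite -{2}(odd_double_half x) ox mul2n add1n.
Qed.

Lemma nil_reduced_odd_partition (N : nat) : reduced_odd_partition N [::].
Proof. by []. Qed.

(* Main.v *)
(* A lecture hall sequence is determined by its gaps: the amounts by which its  *)
(* entries exceed the least value allowed by the next entry. This identifies    *)
(* lecture hall partitions of width N, as well as odd partitions (through their *)
(* multiplicities), with N^N, and in both cases the reduced ones with the cell  *)
(* of the g with g_j < N - j. Without reduction the two weights on N^N are      *)
(* equidistributed: this is the lecture hall theorem, for which we follow       *)
(* Bousquet-Melou and Eriksson: writing o and e for the sums of the entries of  *)
(* weight n, n - 2, ... and n - 1, n - 3, ..., adding an entry on top of a      *)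
(* reflected sequence of width n - 1 turns (o, e) into (2 * o - e + s, o).      *)
(* Both weights increase by a constant when N - j is added to g_j, and the two  *)
(* multisets of constants agree, so sieving out the nonreduced points one       *)
(* coordinate at a time preserves equidistribution. *)

Require Import Defs.
From mathcomp Require Import all_boot all_order all_algebra.
From mathcomp Require Import boolp classical_sets functions cardinality fsbigop.
From mathcomp Require Import zify.
Local Open Scope ring_scope.
Local Open Scope classical_set_scope.
Local Open Scope nat_scope.

(** The two polynomials are compared coefficient by coefficient on [cell N], to which
    [reduced_lecture_hall_bij] and [reduced_odd_partition_bij] carry the two families. A point
    violates the bound at [j] exactly when it arises by adding [N - j] to coordinate [j] of another
    point. Such a shift changes either weight by a constant, so inclusion-exclusion expresses each
    count on the cell through counts on all sequences of length [N] and these constants. The former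
    agree by [level_card_hall], the latter by [hall_perm_weight]; [eq_level_card_box] combines
    them. *)

(** * Least admissible entries and gap coordinates *)

Definition ceil_div (y k : nat) : nat := (y + k.-1) %/ k.

(* For [k > 0] this is the least [x] with [y / k <= x / k.+1]; for [k = 0] it    *)
(* is only used at [y = 0], where it is [0]. *)
Definition lower_bound (y k : nat) : nat := y + ceil_div y k.

Lemma ceil_div_le (y k t : nat) : 0 < k -> (ceil_div y k <= t) = (y <= t * k).
Proof. by move=> k0; rewrite -ltnS ltn_divLR // mulSn; apply/idP/idP; lia. Qed.

Lemma lower_boundP (x y k : nat) : 0 < k ->
  (lower_bound y k <= x) = (y * k.+1 <= x * k).
Proof.
move=> k0; case: (leqP y x) => [yx|xy]; last first.
  by rewrite /lower_bound; apply/idP/idP; nia.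
by rewrite /lower_bound -leq_subRL // ceil_div_le //; apply/idP/idP; nia.
Qed.

Lemma lower_bound0 (k : nat) : lower_bound 0 k = 0.
Proof. by rewrite /lower_bound /ceil_div; case: k => // k; rewrite divn_small. Qed.

(** The right side involves the floor of [x * k / k.+1], the largest entry allowed after [x]; it is
    the upper end of the intervals reversed by [flip]. *)
Lemma lower_bound_upper (x y k : nat) : 0 < k ->
  (lower_bound y k <= x) = (y <= x - ceil_div x k.+1).
Proof.
move=> k0; rewrite lower_boundP //.
have cx : ceil_div x k.+1 <= x by rewrite ceil_div_le //; nia.
case: (leqP y x) => [yx|xy]; last by apply/idP/idP; nia.
rewrite leq_subRL // addnC -leq_subRL // ceil_div_le //.
by apply/idP/idP; nia.
Qed.

(** Adding its weight to an entry raises its ratio by 1, hence also the least admissible ratio of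
    the entry before it. *)
Lemma lower_bound_addr (y k : nat) : 0 < k ->
  lower_bound (y + k) k = lower_bound y k + k.+1.
Proof.
move=> k0.
by rewrite /lower_bound /ceil_div [y + k + k.-1]addnAC divnDr // divnn k0; lia.
Qed.

(* The entry of [a] at position [i] carries the weight [size a - i], and is not *)
(* required to be positive. *)
Fixpoint hall (a : seq nat) : bool :=
  if a is x :: a' then (lower_bound (head 0 a') (size a') <= x) && hall a'
  else true.

Fixpoint of_gaps (g : seq nat) : seq nat :=
  if g is x :: g' then
    (x + lower_bound (head 0 (of_gaps g')) (size g')) :: of_gaps g'
  else [::].

Fixpoint gaps (a : seq nat) : seq nat :=
  if a is x :: a' then (x - lower_bound (head 0 a') (size a')) :: gaps a'
  else [::].

Lemma size_of_gaps (g : seq nat) : size (of_gaps g) = size g.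
Proof. by elim: g => //= x g ->. Qed.

Lemma size_gaps (a : seq nat) : size (gaps a) = size a.
Proof. by elim: a => //= x a ->. Qed.

Lemma hall_of_gaps (g : seq nat) : hall (of_gaps g).
Proof. by elim: g => //= x g ->; rewrite size_of_gaps leq_addl. Qed.

Lemma of_gapsK : cancel of_gaps gaps.
Proof. by elim=> //= x g ->; rewrite size_of_gaps addnK. Qed.

Lemma gapsK (a : seq nat) : hall a -> of_gaps (gaps a) = a.
Proof.
by elim: a => //= x a IH /andP[xa /IH ->]; rewrite size_gaps subnK.
Qed.

Lemma nth_gaps (a : seq nat) (i : nat) : i < size a ->
  nth 0 (gaps a) i
    = nth 0 a i - lower_bound (nth 0 a i.+1) (size a - i.+1).
Proof.
elim: a i => //= x a IH [|i] /=; first by rewrite subSS subn0 nth0.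
by rewrite ltnS => /IH ->; rewrite subSS.
Qed.

Lemma hallP (a : seq nat) :
  reflect (forall i, i < size a ->
             lower_bound (nth 0 a i.+1) (size a - i.+1) <= nth 0 a i)
          (hall a).
Proof.
elim: a => [|x a IH] /=; first by constructor.
apply: (iffP andP) => [[xa /IH ha] [|i] /=|h].
- by rewrite subSS subn0 nth0.
- by rewrite ltnS subSS; exact: ha.
split; first by have := h 0 isT; rewrite /= subSS subn0 nth0.
by apply/IH => i ia; have := h i.+1 ia; rewrite /= subSS.
Qed.

(** * The lecture hall theorem by reflection *)

Definition top_sums (a : seq nat) : nat * nat :=
  foldr (fun x p => (x + p.2, p.1)) (0, 0) a.

Lemma top_sums_sumn (a : seq nat) : (top_sums a).1 + (top_sums a).2 = sumn a.
Proof. by elim: a => //= x a <-; lia. Qed.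

(* With the entries of weight [size a, size a - 2, ...] fixed, each remaining  *)
(* entry ranges over an interval independently of the others, and [flip]       *)
(* reverses these intervals. *)
Fixpoint flip (a : seq nat) : seq nat :=
  if a is x :: a1 then
    if a1 is y :: a2 then
      x :: (x - ceil_div x (size a2).+2
            + lower_bound (head 0 a2) (size a2) - y) :: flip a2
    else [:: x]
  else [::].

Lemma seq_ind2 (T : Type) (P : seq T -> Prop) :
  P [::] -> (forall x, P [:: x]) ->
  (forall x y s, P s -> P [:: x, y & s]) -> forall s, P s.
Proof.
move=> P0 P1 P2 s; suff [] : P s /\ forall x, P (x :: s) by [].
elim: s => [|y s [Ps PsS]]; first by split.
by split=> [|x]; [exact: PsS | exact: P2].
Qed.

Lemma size_flip (a : seq nat) : size (flip a) = size a.
Proof. by elim/seq_ind2: a => //= x y a ->. Qed.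

Lemma head_flip (a : seq nat) : head 0 (flip a) = head 0 a.
Proof. by case: a => [|x [|y a]]. Qed.

Lemma hall_flip (a : seq nat) : hall a -> hall (flip a).
Proof.
elim/seq_ind2: a => // x y a IH; rewrite /= !size_flip head_flip.
rewrite !(lower_bound_upper _ _ (size a).+1) // => /and3P[yx ay /IH ->]; rewrite andbT.
by apply/andP; split; lia.
Qed.

Lemma flipK (a : seq nat) : hall a -> flip (flip a) = a.
Proof.
elim/seq_ind2: a => // x y a IH; rewrite /= !size_flip head_flip.
rewrite (lower_bound_upper _ _ (size a).+1) // => /and3P[yx ay /IH ->].
by congr [:: _, _ & _]; lia.
Qed.

Lemma flip_top_sums1 (a : seq nat) : (top_sums (flip a)).1 = (top_sums a).1.
Proof. by elim/seq_ind2: a => //= x y a ->. Qed.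

(* The bounds contributed by an entry [x] of weight [k] to its two neighbours  *)
(* add up to [2 * x], since [ceil_div x k] cancels. *)
Lemma flip_top_sums2 (a : seq nat) : hall a ->
  lower_bound (head 0 a) (size a) + (top_sums (flip a)).2 + (top_sums a).2
    = 2 * (top_sums a).1.
Proof.
elim/seq_ind2: a => [||x y a IH] //=.
  by move=> x; rewrite /lower_bound /ceil_div divn1; lia.
rewrite (lower_bound_upper _ _ (size a).+1) // => /and3P[yx ay /IH].
have cx : ceil_div x (size a).+2 <= x by rewrite ceil_div_le //; nia.
by rewrite [lower_bound x _]/lower_bound; lia.
Qed.

Fixpoint hall_of (c : seq nat) : seq nat :=
  if c is s :: c' then
    (s + lower_bound (head 0 (hall_of c')) (size c')) :: flip (hall_of c')
  else [::].

(** The argument [n] stands for the length: the recursive call is on [flip a'], which is not a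
    subterm of [a]. *)
Fixpoint of_hall (n : nat) (a : seq nat) : seq nat :=
  if n is n'.+1 then
    if a is x :: a' then
      (x - lower_bound (head 0 a') (size a')) :: of_hall n' (flip a')
    else [::]
  else [::].

Lemma size_hall_of (c : seq nat) : size (hall_of c) = size c.
Proof. by elim: c => //= s c IH; rewrite size_flip IH. Qed.

Lemma hall_hall_of (c : seq nat) : hall (hall_of c).
Proof.
elim: c => //= s c IH; rewrite head_flip size_flip size_hall_of leq_addl.
exact: hall_flip.
Qed.

Lemma hall_ofK (n : nat) (c : seq nat) : size c = n -> of_hall n (hall_of c) = c.
Proof.
elim: n c => [|n IH] [|s c] //= [cn].
rewrite head_flip size_flip size_hall_of addnK flipK ?hall_hall_of //.
by rewrite IH.
Qed.

Lemma of_hallK (n : nat) (a : seq nat) : size a = n -> hall a ->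
  size (of_hall n a) = n /\ hall_of (of_hall n a) = a.
Proof.
elim: n a => [|n IH] [|x a] //= [an] /andP[xa ha].
have [|-> ->] := IH (flip a) _ (hall_flip _ ha); first by rewrite size_flip.
by rewrite head_flip flipK // an subnK // -an.
Qed.

Definition odd_weight (c : seq nat) : nat :=
  \sum_(i < size c) (2 * i + 1) * nth 0 c i.

Lemma odd_weight_cons (s : nat) (c : seq nat) :
  odd_weight (s :: c) = s + odd_weight c + 2 * sumn c.
Proof.
rewrite /odd_weight /= big_ord_recl /= mul1n -addnA; congr (_ + _).
rewrite sumnE (big_nth 0) big_mkord big_distrr -big_split /=.
by apply: eq_bigr => i _; rewrite -mulnDl /bump /=; congr (_ * _); lia.
Qed.

Lemma sumn_hall_of (c : seq nat) : sumn (hall_of c) = odd_weight c.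
Proof.
rewrite -top_sums_sumn.
(* The invariant [o - e = sumn c] is carried along: a step sends [(o, e)] to [(2 * o - e + s, o)],
   so [o - e] grows by [s] and the total by [s + 2 * (o - e)], as in [odd_weight_cons]. *)
suff [] : (top_sums (hall_of c)).1 = (top_sums (hall_of c)).2 + sumn c /\
  (top_sums (hall_of c)).1 + (top_sums (hall_of c)).2 = odd_weight c by [].
elim: c => [|s c [IH1 IH2]]; first by rewrite /odd_weight big_ord0.
rewrite odd_weight_cons /= flip_top_sums1.
have := flip_top_sums2 _ (hall_hall_of c); rewrite size_hall_of.
by lia.
Qed.

(** * Effect of a coordinate shift on the two weights *)

(** By [lower_bound_addr] the increase propagates to the front: each entry up to [j] grows by
    exactly its weight. The statement on the head drives the induction. *)
Lemma of_gaps_shift (g : seq nat) (j : nat) : j < size g ->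
  let g' := set_nth 0 g j (nth 0 g j + (size g - j)) in
  head 0 (of_gaps g') = head 0 (of_gaps g) + size g /\
  sumn (of_gaps g') = sumn (of_gaps g) + \sum_(i < j.+1) (size g - i).
Proof.
elim: g j => //= x g IH [|j] /=.
  by rewrite big_ord1 !subn0; split; lia.
rewrite ltnS subSS => jg; have [hd sm] := IH j jg.
rewrite hd sm size_set_nth (maxn_idPr jg) lower_bound_addr; last by lia.
split; first by lia.
rewrite [in RHS]big_ord_recl /= subn0.
under [in RHS]eq_bigr do rewrite /bump /= add1n subSS.
by lia.
Qed.

Lemma odd_weight_shift (g : seq nat) (j n : nat) : j < size g ->
  odd_weight (set_nth 0 g j (nth 0 g j + n)) = odd_weight g + (2 * j + 1) * n.
Proof.
move=> jg; rewrite /odd_weight size_set_nth (maxn_idPr jg).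
rewrite (bigD1 (Ordinal jg)) //= [in RHS](bigD1 (Ordinal jg)) //=.
rewrite nth_set_nth /= eqxx mulnDr addnAC; congr (_ + _ + _).
apply: eq_bigr => i; rewrite -val_eqE /= nth_set_nth /=.
by move=> /negPf ->.
Qed.

(** * Sieving one coordinate at a time *)

Definition box (n : nat) (d : nat -> nat) (js : seq nat) : set (seq nat) :=
  [set g | size g = n /\ all (fun j => nth 0 g j < d j) js].

Definition level_card {T : choiceType} (A : set T) (W : T -> nat) (m : nat) : int :=
  (\sum_(g \in A `&` [set g | W g = m]) (1 : int))%R.

Lemma finite_level (n m : nat) (A : set (seq nat)) (W : seq nat -> nat) :
  A `<=` [set g | size g = n] ->
  (forall g i, size g = n -> i < n -> nth 0 g i <= W g) ->
  finite_set (A `&` [set g | W g = m]).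
Proof.
move=> An Wb; apply: (sub_finite_set _ (finite_bounded_seq m n)) => g [/An /= gn] <-.
rewrite gn; split=> //; apply/(all_nthP 0) => i; rewrite gn; exact: Wb.
Qed.

(** A point violating the bound at [j] is the shift by [d j] of a unique point of weight [m - w j],
    still in [box n d js] because [j] is not in [js]. *)
Lemma level_card_peel (n : nat) (d w : nat -> nat) (W : seq nat -> nat)
    (j : nat) (js : seq nat) (m : nat) :
  (forall g i, size g = n -> i < n -> nth 0 g i <= W g) ->
  (forall g, size g = n -> W (set_nth 0 g j (nth 0 g j + d j)) = W g + w j) ->
  j < n -> j \notin js ->
  (level_card (box n d (j :: js)) W m = level_card (box n d js) W m
    - (if (w j <= m)%N then level_card (box n d js) W (m - w j) else 0))%R.
Proof.
move=> Wb Wj jn jjs; rewrite /level_card.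
set A := box n d js `&` _.
have finA : finite_set A by apply: (finite_level n) => // g [].
have size_shift g v : size g = n -> size (set_nth 0 g j v) = n.
  by move=> gn; rewrite size_set_nth gn (maxn_idPr jn).
have all_shift g v : all (fun i => nth 0 (set_nth 0 g j v) i < d i) js
    = all (fun i => nth 0 g i < d i) js.
  apply: eq_in_all => i ijs; rewrite nth_set_nth /=.
  by case: eqP => // ij; rewrite -ij ijs in jjs.
have shiftK g v v' : set_nth 0 (set_nth 0 g j v) j v' = set_nth 0 g j v'.
  by rewrite set_set_nth eqxx.
have set_self g : size g = n -> set_nth 0 g j (nth 0 g j) = g.
  move=> gn; apply: (@eq_from_nth _ 0) => [|i _]; first by rewrite size_shift.
  by rewrite nth_set_nth /=; case: eqP => [->|].
rewrite (fsbigID [set g | nth 0 g j < d j] A) //=.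
rewrite (_ : A `&` _ = box n d (j :: js) `&` [set g | W g = m]); last first.
  apply/seteqP; split=> [g [[[gn gjs] Wg] gj]|g [[gn /= /andP[gj gjs]] Wg]] //.
  by split=> //; split=> //=; rewrite gj.
have AE : A `&` ~` [set g | nth 0 g j < d j] `<=` [set g | w j <= m /\
    let g' := set_nth 0 g j (nth 0 g j - d j) in
    [/\ box n d js g', W g' = m - w j & g = set_nth 0 g' j (nth 0 g' j + d j)]].
  move=> g [[[gn gjs] /= Wg] /negP]; rewrite -leqNgt => dg.
  set g' := set_nth _ _ _ _.
  have gE : set_nth 0 g' j (nth 0 g' j + d j) = g.
    by rewrite /g' shiftK // nth_set_nth /= eqxx subnK // set_self.
  have g'n : size g' = n by rewrite size_shift.
  have := Wj _ g'n; rewrite gE Wg => ->; split; first by rewrite leq_addl.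
  by split=> //; [split=> //; rewrite all_shift | rewrite addnK].
case: leqP => [wm|mw]; last first.
  rewrite (_ : _ `&` ~` _ = set0); first by rewrite fsbig_set0 GRing.addr0 GRing.subr0.
  by apply/seteqP; split=> // g /AE [] /=; rewrite leqNgt mw.
rewrite (reindex_fsbig (fun g => set_nth 0 g j (nth 0 g j + d j))
  (box n d js `&` [set g | W g = m - w j])
  (A `&` ~` [set g | nth 0 g j < d j])) ?GRing.addrK //.
split.
- move=> g [[gn gjs] /= Wg]; rewrite /A /= nth_set_nth /= eqxx; split.
    split; first by split; [rewrite size_shift | rewrite all_shift].
    by rewrite Wj // Wg subnK.
  by apply/negP; rewrite -leqNgt leq_addl.
- move=> g1 g2; rewrite !inE => -[[g1n _] _] [[g2n _] _] /= E.
  have E1 : nth 0 g1 j = nth 0 g2 j.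
    by have := congr1 (nth 0 ^~ j) E; rewrite !nth_set_nth /= eqxx => /addIn.
  have := congr1 (fun g => set_nth 0 g j (nth 0 g2 j)) E.
  by rewrite /= !shiftK // -{1}E1 !set_self.
- move=> g /AE [_ /= [g'box Wg' gE]].
  by exists (set_nth 0 g j (nth 0 g j - d j)).
Qed.

(** Peeling gives both counts the same recursion, which sees the list of constants but neither the
    coordinates nor their bounds. *)
Lemma eq_level_card_box (n : nat) (d d' w w' : nat -> nat) (W W' : seq nat -> nat)
    (js js' : seq nat) :
  (forall g i, size g = n -> i < n -> nth 0 g i <= W g) ->
  (forall g i, size g = n -> i < n -> nth 0 g i <= W' g) ->
  (forall g j, size g = n -> j < n ->
     W (set_nth 0 g j (nth 0 g j + d j)) = W g + w j) ->
  (forall g j, size g = n -> j < n ->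
     W' (set_nth 0 g j (nth 0 g j + d' j)) = W' g + w' j) ->
  uniq js -> uniq js' -> all (ltn^~ n) js -> all (ltn^~ n) js' ->
  map w js = map w' js' ->
  level_card [set g | size g = n] W =1 level_card [set g | size g = n] W' ->
  level_card (box n d js) W =1 level_card (box n d' js') W'.
Proof.
move=> Wb Wb' Wj Wj' + + + + + eqW.
elim: js js' => [|j js IH] [|j' js'] //=.
  have boxE e : box n e [::] = [set g | size g = n].
    by apply/seteqP; split=> [g []|g gn].
  by rewrite !boxE.
move=> /andP[jjs ujs] /andP[jjs' ujs'] /andP[jn jsn] /andP[jn' jsn'] [wj ws] m.
rewrite (level_card_peel _ _ w) ?(level_card_peel _ _ w') //; last 2 first.
- by move=> g gn; apply: Wj'.
- by move=> g gn; apply: Wj.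
by rewrite wj !(IH js').
Qed.

(* Adding [n - j] to gap [j] adds [\sum_(i < j.+1) (n - i)] to the size of a    *)
(* lecture hall sequence and [(2 * j + 1) * (n - j)] to the odd weight; this    *)
(* permutation matches the two families of increments. *)
Definition hall_perm (n j : nat) : nat := if odd j then n - uphalf j else j./2.

Lemma perm_hall_perm (n : nat) :
  perm_eq (map (hall_perm n) (iota 0 n)) (iota 0 n).
Proof.
have inj : {in iota 0 n &, injective (hall_perm n)}.
  move=> i j; rewrite !mem_iota /= !add0n => i_n jn; rewrite /hall_perm.
  by case: ifP => oi; case: ifP => oj; lia.
have u : uniq (map (hall_perm n) (iota 0 n)).
  by rewrite map_inj_in_uniq ?iota_uniq.
have sub : {subset map (hall_perm n) (iota 0 n) <= iota 0 n}.
  move=> k /mapP[j]; rewrite !mem_iota !add0n /= => jn ->.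
  by rewrite /hall_perm; case: ifP; lia.
apply: uniq_perm => //; first exact: iota_uniq.
by apply: (uniq_min_size u sub _).2; rewrite size_map.
Qed.

(** Twice the sum is [j.+1 * (2 * n - j)], a product of an even and an odd factor; the odd one is
    [2 * hall_perm n j + 1]. *)
Lemma hall_perm_weight (n j : nat) : j < n ->
  \sum_(i < j.+1) (n - i)
    = (2 * hall_perm n j + 1) * (n - hall_perm n j).
Proof.
move=> jn.
have S : 2 * \sum_(i < j.+1) (n - i) = j.+1 * (2 * n - j).
  elim: j jn => [|j IH] jn; first by rewrite big_ord1 !subn0 mul1n.
  by rewrite big_ord_recr mulnDr IH /=; [nia | lia].
suff : 2 * ((2 * hall_perm n j + 1) * (n - hall_perm n j)) = j.+1 * (2 * n - j).
  by lia.
rewrite /hall_perm; case: ifP => oj.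
  have [k jE] : exists k, j = 2 * k + 1 by exists j./2; lia.
  rewrite jE (_ : uphalf _ = k.+1) in jn *; last by lia.
  have [l nE] : exists l, n = k.+1 + l by exists (n - k.+1); lia.
  rewrite nE addKn addnK (_ : 2 * (k.+1 + l) - (2 * k + 1) = 2 * l + 1); lia.
have [k jE] : exists k, j = 2 * k by exists j./2; lia.
rewrite jE (_ : _./2 = k) in jn *; last by lia.
have [l nE] : exists l, n = k + l by exists (n - k); lia.
rewrite nE addKn (_ : 2 * (k + l) - 2 * k = 2 * l); lia.
Qed.

(** * Equidistribution, without and with reduction *)

Lemma level_card_hall (n : nat) :
  level_card [set g | size g = n] (sumn \o of_gaps)
    =1 level_card [set g | size g = n] odd_weight.
Proof.
pose H := [set a | size a = n /\ hall a].
move=> m; transitivity (level_card H sumn m); rewrite /level_card.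
  apply/esym/(reindex_fsbig of_gaps); split=> [g [gn Wg]|g g' _ _|a [[an ha] Wa]].
  - by split=> //; split; [rewrite size_of_gaps | apply: hall_of_gaps].
  - exact: (can_inj of_gapsK).
  - by exists (gaps a); rewrite ?gapsK //; split; rewrite /= ?size_gaps ?gapsK.
apply: (reindex_fsbig hall_of); split=> [c [cn Wc]|c c'|a [[an ha] Wa]].
- split; last by rewrite /= sumn_hall_of.
  by split; [rewrite size_hall_of | apply: hall_hall_of].
- rewrite !inE => -[/= cn _] [c'n _] E.
  by rewrite -(hall_ofK _ _ cn) E hall_ofK.
- have [sz E] := of_hallK _ _ an ha; exists (of_hall n a) => //.
  by split=> //=; rewrite -sumn_hall_of E.
Qed.

(** Here [n - j] is the weight of entry [j] on the lecture hall side, and the least forbidden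
    multiplicity of [2 * j + 1] on the odd side. *)
Definition cell (n : nat) : set (seq nat) :=
  [set g | size g = n /\ forall j, j < n -> nth 0 g j < n - j].

Lemma cellE (n : nat) : cell n = box n (subn n) (iota 0 n).
Proof.
apply/seteqP; split=> g [gn gP]; split=> //.
  by apply/allP => j; rewrite mem_iota => /gP.
by move=> j jn; apply: (allP gP); rewrite mem_iota.
Qed.

Lemma level_card_cell (n : nat) :
  level_card (cell n) (sumn \o of_gaps) =1 level_card (cell n) odd_weight.
Proof.
(* The order of sieving is free; listing coordinates through [hall_perm] makes the constants on both
   sides agree term by term. *)
have -> : level_card (cell n) odd_weight
    = level_card (box n (subn n) (map (hall_perm n) (iota 0 n))) odd_weight.
  rewrite cellE; congr (level_card _ _); apply/seteqP.
  by split=> g [gn gP]; split=> //; move: gP; rewrite (perm_all _ (perm_hall_perm n)).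
rewrite cellE.
apply: (eq_level_card_box _ _ _ (fun j => \sum_(i < j.+1) (n - i))
          (fun j => (2 * j + 1) * (n - j))).
- move=> g i gn; rewrite -gn => ig /=.
  elim: g i {gn} ig => //= x g IH [|i] ig /=; first by lia.
  by apply: leq_trans (IH i ig) _; lia.
- move=> g i gn; rewrite -gn => ig; rewrite /odd_weight (bigD1 (Ordinal ig)) //=.
  by nia.
- by move=> g j gn jn /=; have [|_] := of_gaps_shift g j; rewrite gn.
- by move=> g j gn jn; rewrite odd_weight_shift ?gn.
- exact: iota_uniq.
- by rewrite (perm_uniq (perm_hall_perm n)) iota_uniq.
- by apply/allP => j; rewrite mem_iota.
- by rewrite (perm_all _ (perm_hall_perm n)); apply/allP => j; rewrite mem_iota.
- rewrite -map_comp; apply/eq_in_map => j; rewrite mem_iota add0n => /= jn.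
  exact: hall_perm_weight.
exact: level_card_hall.
Qed.

(** * Odd partitions and their multiplicities *)

Definition odd_mults (n : nat) (la : seq nat) : seq nat :=
  mkseq (fun j => count_mem (2 * j + 1) la) n.

Lemma odd_weight_mults (n : nat) (la : seq nat) :
  (forall p, p \in la -> odd p /\ p <= 2 * n) ->
  odd_weight (odd_mults n la) = sumn la.
Proof.
rewrite /odd_weight size_mkseq => odd_la.
under eq_bigr do rewrite nth_mkseq //.
elim: la odd_la => [|p la IH] odd_la /=; first by rewrite big1 // => i _; rewrite muln0.
rewrite -{}IH => [|x x_la]; last by apply: odd_la; rewrite in_cons x_la orbT.
have [op pn] := odd_la p (mem_head _ _).
have pn2 : p./2 < n by lia.
under eq_bigr do rewrite mulnDr.
rewrite big_split /=; congr (_ + _).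
rewrite (bigD1 (Ordinal pn2)) //= (_ : p == _); last by apply/eqP; lia.
rewrite big1 ?muln1 => [|i]; first by lia.
rewrite -val_eqE /= => ip; case: eqP => [pE|_]; last by rewrite muln0.
by case/eqP: ip; lia.
Qed.

Lemma reduced_odd_partition_bij (n : nat) :
  set_bij (reduced_odd_partition n) (cell n) (odd_mults n).
Proof.
have count0 la x : odd_partition n la -> ~~ (odd x && (x <= 2 * n)) ->
    count_mem x la = 0.
  move=> [_ odd_la] xn; apply/count_memPn; apply: contra xn => /odd_la.
  by move=> [-> ->].
split.
- move=> la [_ la_red]; split; first exact: size_mkseq.
  move=> j jn; rewrite nth_mkseq //; have := la_red j.+1.
  by rewrite (_ : 2 * j.+1 - 1 = 2 * j + 1); lia.
- move=> la la'; rewrite !inE => -[odd_la _] [odd_la' _] eqm.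
  apply: (@sorted_eq _ geq); first 4 last.
  + apply/allP => x _ /=; apply/eqP.
    have [/andP[ox xn]|xn] := boolP (odd x && (x <= 2 * n)); last by rewrite !count0.
    have jn : x./2 < n by lia.
    rewrite (_ : x = 2 * x./2 + 1); last by lia.
    by have := congr1 (nth 0 ^~ x./2) eqm; rewrite !nth_mkseq.
  + by move=> x y z yx xz; apply: leq_trans yx.
  + by move=> x y; rewrite andbC -eqn_leq => /eqP.
  + by have [/andP[]] := odd_la.
  + by have [/andP[]] := odd_la'.
move=> g [gn g_red].
pose la := flatten [seq nseq (nth 0 g j) (2 * j + 1) | j <- iota 0 n].
have count_la j : j < n -> count_mem (2 * j + 1) la = nth 0 g j.
  move=> jn; rewrite count_flatten -map_comp sumnE big_map.
  rewrite (bigD1_seq j) ?mem_iota ?iota_uniq //= count_nseq /= eqxx mul1n.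
  rewrite big1 ?addn0 // => i ij; rewrite count_nseq /=.
  by case: eqP => // E; case/eqP: ij; lia.
have mem_la p : p \in la -> odd p /\ p <= 2 * n.
  case/flatten_mapP => j; rewrite mem_iota => /andP[_ jn] /nseqP[-> _].
  by split; lia.
have sort_count x : count_mem x (sort geq la) = count_mem x la.
  by apply/permP; rewrite perm_sort.
exists (sort geq la); last first.
  apply: (@eq_from_nth _ 0) => [|j]; rewrite size_mkseq // => jn.
  by rewrite nth_mkseq // sort_count count_la.
split; last first.
  move=> k /andP[k0 kn]; rewrite (_ : 2 * k - 1 = 2 * k.-1 + 1); last by lia.
  have kn' : k.-1 < n by lia.
  by rewrite sort_count count_la //; have := g_red _ kn'; lia.
split; last by move=> p; rewrite mem_sort => /mem_la.
apply/andP; split; first by apply: sort_sorted => x y; exact: leq_total.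
by rewrite mem_sort; apply/negP => /mem_la [].
Qed.

(** * Lecture hall partitions as zero-padded sequences *)

Definition pos_part (a : seq nat) : seq nat := [seq x <- a | 0 < x].

Lemma nth_pos_part (a : seq nat) (i : nat) : sorted geq a ->
  nth 0 (pos_part a) i = nth 0 a i.
Proof.
have geq_trans : transitive geq by move=> x y z yx xz; apply: leq_trans yx.
elim: a i => // x a IH i xa; have sa := path_sorted xa.
case: (posnP x) => [x0|x_gt0] /=; last by rewrite x_gt0; case: i => //= i; rewrite IH.
rewrite x0 ltnn IH //; case: i => //= [|i].
  case: a xa {IH sa} => //= y a /andP[]; lia.
have /allP a0 := order_path_min geq_trans xa.
have [ia|ai] := ltnP i (size a); last by rewrite !nth_default // ltnW.
have ge0 j : nth 0 a j = 0.
  have [ja|aj] := ltnP j (size a); last by rewrite nth_default.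
  by have := a0 _ (mem_nth 0 ja); rewrite x0 /=; lia.
by rewrite !ge0.
Qed.

Lemma sumn_pos_part (a : seq nat) : sumn (pos_part a) = sumn a.
Proof. by elim: a => //= -[|x] a //= ->. Qed.

Lemma hall_sorted (a : seq nat) : hall a -> sorted geq a.
Proof.
elim: a => // x [|y a] //= IH /andP[yx /IH ->]; rewrite andbT.
by apply: leq_trans yx; rewrite /lower_bound leq_addr.
Qed.

Lemma ratio_leE (x y k : nat) : 0 < k ->
  (y%:R / k%:R <= x%:R / k.+1%:R :> rat)%R = (lower_bound y k <= x).
Proof.
move=> k0; rewrite lower_boundP // Num.Theory.ler_pdivrMr ?Num.Theory.ltr0n //.
rewrite GRing.mulrAC Num.Theory.ler_pdivlMr ?Num.Theory.ltr0n //.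
by rewrite -!GRing.natrM Num.Theory.ler_nat.
Qed.

Lemma lecture_hall_pos_part (a : seq nat) :
  hall a -> lecture_hall (size a) (pos_part a).
Proof.
move=> ha; have sa := hall_sorted _ ha; split.
- apply/andP; split; last by rewrite mem_filter.
  by apply: sorted_filter sa => x y z yx xz; apply: leq_trans yx.
- by rewrite size_filter count_size.
move=> i; rewrite size_filter => ia; have {}ia := leq_trans ia (count_size _ _).
rewrite !nth_pos_part // (_ : size a - i = (size a - i.+1).+1); last by lia.
by rewrite ratio_leE; [apply: (hallP _ ha); lia | lia].
Qed.

Lemma lecture_hall_lower_bound (n i : nat) (mu : seq nat) :
  lecture_hall n mu -> i < n ->
  lower_bound (nth 0 mu i.+1) (n - i.+1) <= nth 0 mu i.
Proof.
move=> [_ mun hmu] i_n; have [imu|mui] := ltnP i.+1 (size mu); last first.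
  by rewrite nth_default // lower_bound0.
rewrite -ratio_leE; last by lia.
by rewrite (_ : (n - i.+1).+1 = n - i); [exact: hmu | lia].
Qed.

Lemma lecture_hall_pad (n : nat) (mu : seq nat) : lecture_hall n mu ->
  exists a, [/\ size a = n, hall a & pos_part a = mu].
Proof.
move=> hmu; have [/andP[_ mu0] mun _] := hmu.
have sz : size (mu ++ nseq (n - size mu) 0) = n by rewrite size_cat size_nseq subnKC.
exists (mu ++ nseq (n - size mu) 0); split=> //.
- apply/hallP; rewrite sz => i i_n.
  have nthE j : nth 0 (mu ++ nseq (n - size mu) 0) j = nth 0 mu j.
    by rewrite nth_cat nth_nseq; case: ltnP => // muj; rewrite if_same nth_default.
  by rewrite !nthE; apply: lecture_hall_lower_bound.
rewrite /pos_part filter_cat filter_nseq cats0; apply/all_filterP/allP => x xmu.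
by rewrite lt0n; apply: contraNneq mu0 => <-.
Qed.

(* Subtracting [n - i] from the entry of weight [n - i] decreases its gap by as *)
(* much, and can only increase the other gaps. *)
Lemma reduced_gaps (n : nat) (a : seq nat) : size a = n -> hall a ->
  reduced_lecture_hall n (pos_part a) <-> cell n (gaps a).
Proof.
move=> an ha; have sa := hall_sorted _ ha.
have LHa : lecture_hall n (pos_part a) by rewrite -an; apply: lecture_hall_pos_part.
split=> [[_ red]|[_ gap_lt]].
  split; first by rewrite size_gaps.
  move=> i i_n; rewrite ltnNge; apply/negP; rewrite nth_gaps ?an // => gap_ge.
  apply: (red i).
    (* A gap of at least [n - i > 0] makes entry [i] positive, hence kept by [pos_part]. *)
    by rewrite ltnNge; apply/negP => /(nth_default 0); rewrite nth_pos_part //; lia.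
  pose b := set_nth 0 a i (nth 0 a i - (n - i)).
  have bn : size b = n by rewrite size_set_nth an (maxn_idPr i_n).
  have hb : hall b.
    apply/hallP; rewrite bn => k kn; rewrite /b !nth_set_nth /=.
    have := hallP _ ha k; rewrite an => /(_ kn).
    case: (k =P i) => [->|_]; first by rewrite (gtn_eqF (ltnSn i)); lia.
    case: eqP => // kE; rewrite kE => /(leq_trans _); apply.
    rewrite /lower_bound /ceil_div leq_add ?leq_subr // leq_div2r //.
    by rewrite leq_add2r leq_subr.
  exists (pos_part b); split; first by rewrite -bn; apply: lecture_hall_pos_part.
  move=> j; rewrite !nth_pos_part ?hall_sorted // nth_set_nth /=.
  by case: eqP => [->|_]; lia.
split=> // i imu [nu [LHnu red]].
have i_n : i < n by have [_ mun _] := LHa; apply: leq_trans mun.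
(* Since [nu] loses [n - i] at [i] and nothing at [i.+1], its condition there would force gap [i] to
   be at least [n - i]. *)
have := lecture_hall_lower_bound _ _ _ LHnu i_n.
have := gap_lt i i_n; rewrite nth_gaps ?an //.
have := red i.+1; have := red i; rewrite eqxx (gtn_eqF (ltnSn i)) GRing.subr0.
rewrite !nth_pos_part // => nui [->]; lia.
Qed.

Lemma reduced_lecture_hall_bij (n : nat) :
  set_bij (cell n) (reduced_lecture_hall n) (pos_part \o of_gaps).
Proof.
split=> [g gcell|g g'|mu redmu].
- have [gn _] := gcell; apply/reduced_gaps; rewrite ?size_of_gaps //.
    exact: hall_of_gaps.
  by rewrite of_gapsK.
- rewrite !inE => -[gn _] [g'n _] /= E; apply: (can_inj of_gapsK).
  apply: (@eq_from_nth _ 0) => [|i _]; first by rewrite !size_of_gaps gn.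
  have sg h : sorted geq (of_gaps h) by rewrite hall_sorted // hall_of_gaps.
  by rewrite -[LHS]nth_pos_part // E nth_pos_part.
have [a [an ha aE]] := lecture_hall_pad _ _ redmu.1.
exists (gaps a); last by rewrite /= gapsK.
by apply/reduced_gaps; rewrite ?aE.
Qed.

(** * From level counts to generating polynomials *)

Lemma coef_fsum_Xn (T : choiceType) (A : set T) (W : T -> nat) (m : nat) :
  finite_set A ->
  ((\sum_(x \in A) ('X^(W x) : {poly int}))`_m = level_card A W m)%R.
Proof.
move=> finA; rewrite /level_card fsbig_mkcondr !fsbig_finite // coef_sum.
apply: eq_bigr => x _; rewrite coefXn.
case: eqP => [mE|Wm]; first by rewrite ifT // inE.
by rewrite ifF //; apply/negP; rewrite inE /= => /esym.
Qed.

Lemma finite_cell (n : nat) : finite_set (cell n).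
Proof.
apply: (sub_finite_set _ (finite_bounded_seq n n)) => g [gn gP] /=.
rewrite gn; split=> //; apply/(all_nthP 0) => i; rewrite gn => i_n.
by apply: leq_trans (ltnW (gP i i_n)) (leq_subr _ _).
Qed.

Local Close Scope nat_scope.

Theorem theorem3p3 (N : nat) (N_gt0 : (0 < N)%N) :
  \sum_(mu \in reduced_lecture_hall N) ('X^(sumn mu) : {poly int})
    = \sum_(la \in reduced_odd_partition N) ('X^(sumn la) : {poly int}).
Proof.
rewrite (reindex_fsbig _ _ _ _ (reduced_lecture_hall_bij N)) /=.
transitivity (\sum_(g \in cell N) ('X^(odd_weight g) : {poly int})).
  under eq_fsbigr do rewrite sumn_pos_part.
  apply/polyP => m; rewrite !coef_fsum_Xn; [|exact: finite_cell..].
  exact: level_card_cell.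
rewrite (reindex_fsbig _ _ _ _ (reduced_odd_partition_bij N)).
apply: eq_fsbigr => la; rewrite inE => -[[_ odd_la] _].
by rewrite odd_weight_mults.
Qed.
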